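(* Let $T$ be a tree on $n \geq 4$ vertices that is not a path. Then the independence system $(T)_{\mathrm{res}}=(V(T),\mathcal I)$, where $\mathcal I$ is the family of all subsets of $V(T)$ that are contained in some minimal resolving set of $T$, is a matroid.
   Context: For a connected graph $G$, $d(u,v)$ is the length of a shortest $u$–$v$ path. A set $R\subseteq V(G)$ is a resolving set if for any two distinct vertices $u,w$ there is $h\in R$ with $d(u,h)\neq d(w,h)$. A minimal resolving set is a resolving set none of whose proper subsets is resolving. The independence system $(G)_{\mathrm{res}}$ has ground set $V(G)$ and independent sets exactly the subsets of minimal resolving sets of $G$. A matroid is an independence system such that for any independent sets $A,B$ with $|A|<|B|$ there is $x\in B\setminus A$ with $A\cup\{x\}$ independent. *)

(* Defs.v *)
From mathcomp Require Import all_boot.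

Set Implicit Arguments.
Unset Strict Implicit.
Unset Printing Implicit Defensive.

Record sgraph := SGraph {
  vertex :> finType;
  edge : rel vertex;
  edge_sym : symmetric edge;
  edge_irrefl : irreflexive edge
}.

Definition connected (G : sgraph) : Prop :=
  forall u v : G, connect (@edge G) u v.

(* A two-vertex sequence joined by an edge also satisfies [ucycle], since it
   traverses that edge back and forth; graph cycles have at least 3 vertices. *)
Definition acyclic (G : sgraph) : Prop :=
  forall c : seq G, 2 < size c -> ~ ucycle (@edge G) c.

Definition is_tree (G : sgraph) : Prop := connected G /\ acyclic G.

Definition graph_iso (G H : sgraph) : Prop :=
  exists f : G -> H,
    bijective f /\ forall u v : G, edge (f u) (f v) = edge u v.

Definition consecutive (n : nat) : rel 'I_n :=
  fun i j => (i.+1 == j :> nat) || (j.+1 == i :> nat).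

Lemma consecutive_sym n : symmetric (@consecutive n).
Proof. by move=> i j; rewrite /consecutive orbC. Qed.

Lemma consecutive_irrefl n : irreflexive (@consecutive n).
Proof. by move=> i; rewrite /consecutive orbb eqn_leq ltnn. Qed.

Definition path_graph (n : nat) : sgraph :=
  SGraph (@consecutive_sym n) (@consecutive_irrefl n).

Definition is_path_graph (G : sgraph) : Prop := graph_iso G (path_graph #|G|).

Definition has_path_of_length (G : sgraph) (u v : G) (k : nat) : bool :=
  [exists p : k.-tuple G,
     [&& path (@edge G) u p, uniq (u :: p) & last u p == v]].

(* The least length of a [u]-[v] path; all such lengths are below [#|G|], and
   the value is the junk [#|G|] when [u] and [v] are not connected. *)
Definition dist (G : sgraph) (u v : G) : nat :=
  find (has_path_of_length u v) (iota 0 #|G|).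

Definition resolving (G : sgraph) (R : {set G}) : bool :=
  [forall u : G, forall w : G,
     (u != w) ==> [exists h in R, dist u h != dist w h]].

Definition minimal_resolving (G : sgraph) (R : {set G}) : bool :=
  minset (@resolving G) R.

Definition res_system (G : sgraph) : {set {set G}} :=
  [set A : {set G} | [exists R : {set G}, minimal_resolving R && (A \subset R)]].

Definition independence_system (V : finType) (I : {set {set V}}) : Prop :=
  set0 \in I /\ forall A B : {set V}, A \subset B -> B \in I -> A \in I.

Definition is_matroid (V : finType) (I : {set {set V}}) : Prop :=
  independence_system I /\
  forall A B : {set V}, A \in I -> B \in I -> #|A| < #|B| ->
    exists2 x, x \in B :\: A & x |: A \in I.

(* Main.v *)
(** A leg is a branch of [T] at a vertex [v] of degree at least 3 (its stem) all
    of whose vertices have degree at most 2.  Two vertices not resolved by [R]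
    are equidistant from the midpoint [v] of the path joining them, and [R]
    misses the two branches at [v] containing them; conversely, two branches at
    [v] missed by [R] give two neighbours of [v] that [R] does not resolve.  As
    [T] is not a path, two branches at a common vertex always contain two legs
    with a common stem: go to a vertex of degree at least 3 farthest from [v].
    So [R] is resolving iff it meets all legs but at most one at every stem.
    Since legs are disjoint, the subsets of minimal resolving sets are the
    sets of leg vertices with at most one vertex in each leg and missing a
    leg at every stem: a direct sum of truncated partition matroids. *)

Require Import Defs.
From mathcomp Require Import all_boot.
From mathcomp Require Import zify.

Set Implicit Arguments.
Unset Strict Implicit.
Unset Printing Implicit Defensive.

(** * Combinatorics of legs grouped by stem *)

(* [own x] is the leg containing [x], if any; [stem l] is the vertex at which the
   leg [l] is attached. *)
Section AlmostTransversals.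

Variables (V L S : finType) (own : V -> option L) (pt : L -> V) (stem : L -> S).
Hypothesis own_pt : forall l, own (pt l) = Some l.

Definition hits (A : {set V}) (l : L) := [exists x in A, own x == Some l].

Definition almost_transversal (A : {set V}) :=
  [forall l, forall l',
     (l != l') && (stem l == stem l') ==> hits A l || hits A l'].

(** The intended independent sets. The last clause ranges over legs rather than stems, so that a
    stem bearing no leg imposes no condition. *)
Definition partial_transversal (A : {set V}) :=
  [&& [forall x in A, own x != None],
      [forall x in A, forall y in A, (own x == own y) ==> (x == y)]
    & [forall l, exists l', (stem l' == stem l) && ~~ hits A l']].

Lemma hitsP (A : {set V}) l :
  reflect (exists2 x, x \in A & own x = Some l) (hits A l).
Proof.
apply: (iffP existsP) => [[x /andP[xA /eqP ox]]|[x xA ox]]; first by exists x.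
by exists x; rewrite xA ox eqxx.
Qed.

Lemma hits_sub (A B : {set V}) l : A \subset B -> hits A l -> hits B l.
Proof. by move=> /subsetP AB /hitsP[x /AB xB ox]; apply/hitsP; exists x. Qed.

Lemma hitsU1 (A : {set V}) x l :
  hits (x |: A) l = (own x == Some l) || hits A l.
Proof.
apply/hitsP/idP => [[y /setU1P[->|yA] oy]|/orP[/eqP ox|/hitsP[y yA oy]]].
- by rewrite oy eqxx.
- by apply/orP; right; apply/hitsP; exists y.
- by exists x; rewrite ?setU11.
- by exists y => //; apply/setU1P; right.
Qed.

Lemma almost_transversalP (A : {set V}) :
  reflect (forall l l', l != l' -> stem l = stem l' -> hits A l || hits A l')
          (almost_transversal A).
Proof.
apply: (iffP forallP) => [H l l' ll' /eqP s|H l].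
  by have /forallP/(_ l')/implyP := H l; apply; rewrite ll' s.
by apply/forallP => l'; apply/implyP => /andP[ll' /eqP]; apply: H.
Qed.

Lemma partial_transversalP (A : {set V}) :
  reflect [/\ forall x, x \in A -> own x != None,
              {in A &, injective own}
            & forall l, exists2 l', stem l' = stem l & ~~ hits A l']
          (partial_transversal A).
Proof.
apply: (iffP and3P) => -[H1 H2 H3]; split.
- by move=> x xA; apply: (implyP (forallP H1 x)).
- move=> x y xA yA /eqP oxy; apply/eqP.
  have /forallP/(_ y)/implyP/(_ yA)/implyP := implyP (forallP H2 x) xA.
  exact.
- by move=> l; have /existsP[l' /andP[/eqP s h]] := forallP H3 l; exists l'.
- by apply/forallP => x; apply/implyP; apply: H1.
- apply/forallP => x; apply/implyP => xA; apply/forallP => y; apply/implyP => yA.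
  by apply/implyP => /eqP oxy; apply/eqP; apply: H2.
- apply/forallP => l; apply/existsP; have [l' s h] := H3 l.
  by exists l'; rewrite s eqxx.
Qed.

Lemma partial_transversal_sub (A B : {set V}) :
  A \subset B -> partial_transversal B -> partial_transversal A.
Proof.
move=> AB /partial_transversalP[H1 H2 H3]; have sAB := subsetP AB.
apply/partial_transversalP; split.
- by move=> x /sAB; apply: H1.
- by move=> x y /sAB xB /sAB yB; apply: H2.
- move=> l; have [l' s h] := H3 l; exists l' => //.
  by apply: contra h; apply: hits_sub.
Qed.

(** Minimality makes every element indispensable. A vertex outside all legs, one of two vertices in
    the same leg, or a vertex in a leg whose stem has all its legs hit could be dropped, the last at
    the cost of at most one missed leg. *)
Lemma minset_partial_transversal (R : {set V}) :
  minset almost_transversal R -> partial_transversal R.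
Proof.
move=> /minsetP[/almost_transversalP tR minR].
have removal x : x \in R ->
    (forall l l', l != l' -> stem l = stem l' ->
       hits (R :\ x) l || hits (R :\ x) l') -> False.
  move=> xR /almost_transversalP /minR/(_ (subD1set _ _)) eqR.
  by move: xR; rewrite -eqR setD11.
have keep x l : own x != Some l -> hits R l -> hits (R :\ x) l.
  move=> ox /hitsP[y yR oy]; apply/hitsP; exists y => //.
  by rewrite in_setD1 yR andbT; apply: contraNneq ox => <-; rewrite oy.
have inj : {in R &, injective own}.
  move=> x y xR yR oxy; apply/eqP/negP => /negP xy; apply: (removal x xR).
  have keepx l : hits R l -> hits (R :\ x) l.
    have [ox _|ox] := eqVneq (own x) (Some l); last exact: keep.
    by apply/hitsP; exists y; rewrite -?oxy // in_setD1 eq_sym xy.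
  by move=> l l' ll' s; apply/orP; case/orP: (tR l l' ll' s) => /keepx; auto.
apply/partial_transversalP; split=> // [x xR|l].
  apply/eqP => ox; apply: (removal x xR) => l l' ll' s.
  by apply/orP; case/orP: (tR l l' ll' s) => h; [left|right];
    apply: keep h; rewrite ox.
have [/existsP[l' /andP[/eqP s h]]|H] :=
  boolP [exists l', (stem l' == stem l) && ~~ hits R l']; first by exists l'.
have allhit l' : stem l' = stem l -> hits R l'.
  move=> s; apply: contraNT H => h; apply/existsP; exists l'.
  by rewrite s eqxx.
have /hitsP[x xR ox] := allhit l erefl.
case: (removal x xR) => l1 l2 l12 s12.
have [e1|n1] := eqVneq l1 l.
  rewrite [hits _ l2]keep ?orbT //; last by apply: allhit; rewrite -s12 e1.
  by rewrite ox; apply: contra l12 => /eqP[<-]; rewrite e1.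
have [e2|n2] := eqVneq l2 l.
  rewrite [hits _ l1]keep //; last by apply: allhit; rewrite s12 e2.
  by rewrite ox; apply: contra n1 => /eqP[<-].
by apply/orP; case/orP: (tR _ _ l12 s12) => h; [left|right]; apply: keep h;
  rewrite ox; [apply: contra n1|apply: contra n2] => /eqP[<-].
Qed.

(** If two legs at one stem were missed, adding the point of one would leave the other free, against
    maximality. For minimality, a missed leg [m] at the stem of the leg of [x] forces any smaller
    almost transversal to hit the leg of [x], where [x] is the only choice. *)
Lemma maxset_minset_transversal (R : {set V}) :
  maxset partial_transversal R -> minset almost_transversal R.
Proof.
move=> /maxsetP[pR maxR]; have /partial_transversalP[H1 H2 H3] := pR.
apply/minsetP; split.
  apply/almost_transversalP => l l' ll' s; apply/negP => /negP.
  rewrite negb_or => /andP[h h'].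
  have ptR : pt l \notin R by apply: contra h => xR; apply/hitsP; exists (pt l).
  suff /maxR/(_ (subsetUr _ _)) eqR : partial_transversal (pt l |: R).
    by move: ptR; rewrite -eqR setU11.
  have fresh y : y \in R -> own y <> Some l.
    by move=> yR oy; case/hitsP: h; exists y.
  apply/partial_transversalP; split.
  - by move=> x /setU1P[->|/H1 //]; rewrite own_pt.
  - move=> x y /setU1P[->|xR] /setU1P[->|yR] //; last exact: H2.
      by rewrite own_pt => /esym /(fresh y yR).
    by rewrite own_pt => /(fresh x xR).
  - move=> k; have [sk|sk] := eqVneq (stem k) (stem l).
      exists l'; rewrite -?s // hitsU1 own_pt negb_or h' andbT.
      by apply: contra ll' => /eqP[->].
    have [k' s' h''] := H3 k; exists k' => //.
    rewrite hitsU1 own_pt negb_or h'' andbT.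
    by apply: contra sk => /eqP[->]; rewrite s'.
move=> R' /almost_transversalP tR' sub; apply/eqP; rewrite eqEsubset sub /=.
apply/subsetP => x xR; case ox: (own x) (H1 x xR) => [l|//] _.
have [m sm hm] := H3 l.
have lm : l != m.
  by apply: contraNneq hm => <-; apply/hitsP; exists x.
case/orP: (tR' l m lm (esym sm)) => [/hitsP[y yR' oy]|/(hits_sub sub)].
  by rewrite (H2 x y) ?ox ?oy // (subsetP sub).
by rewrite (negPf hm).
Qed.

Lemma sub_minset_transversalP (A : {set V}) :
  reflect (exists2 R, minset almost_transversal R & A \subset R)
          (partial_transversal A).
Proof.
apply: (iffP idP) => [/maxset_exists[R mR AR]|[R mR AR]].
  by exists R => //; apply: maxset_minset_transversal.
exact: partial_transversal_sub AR (minset_partial_transversal mR).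
Qed.

Lemma partial_transversal0 : partial_transversal set0.
Proof.
apply/partial_transversalP; split=> [x|x y|l]; rewrite ?inE //.
by exists l => //; apply/hitsP => -[x]; rewrite inE.
Qed.

(** [own] matches the elements of [A] with the legs hit, so cardinalities can be counted in legs and
    then split by stem. *)
Lemma card_hits (A : {set V}) :
  partial_transversal A -> #|[set l | hits A l]| = #|A|.
Proof.
move=> /partial_transversalP[H1 H2 _].
rewrite -(card_in_imset H2) -(card_imset _ Some_inj).
apply: eq_card => o; apply/imsetP/imsetP => [[l]|[x xA ->]].
  by rewrite inE => /hitsP[x xA ox] ->; exists x.
case ox: (own x) (H1 x xA) => [l|//] _; exists l => //.
by rewrite inE; apply/hitsP; exists x.
Qed.

(* Fewer elements overall means fewer at some stem; there a leg hit by [B] only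
   can be added, since [B] still leaves a leg of that stem free. *)
Lemma partial_transversal_exchange (A B : {set V}) :
  partial_transversal A -> partial_transversal B -> #|A| < #|B| ->
  exists2 x, x \in B :\: A & partial_transversal (x |: A).
Proof.
move=> pA pB; rewrite -(card_hits pA) -(card_hits pB) => ltAB.
pose at_stem (C : {set V}) s := [set l | hits C l & stem l == s].
have sumE C : #|[set l | hits C l]| = \sum_s #|at_stem C s|.
  rewrite -sum1_card (partition_big stem predT) //=.
  by apply: eq_bigr => s _; rewrite -sum1_card; apply: eq_bigl => l; rewrite !inE.
have [s lts] : exists s, #|at_stem A s| < #|at_stem B s|.
  apply/existsP; apply: contraTT ltAB => /existsPn H.
  rewrite -leqNgt !sumE; apply: leq_sum => s _; rewrite leqNgt; exact: H.
have [l] : exists l, l \in at_stem B s :\: at_stem A s.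
  apply/set0Pn; rewrite setD_eq0; apply: contraL lts => /subset_leq_card.
  by rewrite leqNgt.
rewrite !inE => /andP[nA /andP[hB /eqP sl]]; move: nA; rewrite sl eqxx andbT => hA.
have /partial_transversalP[A1 A2 A3] := pA.
have /partial_transversalP[_ _ B3] := pB.
have /hitsP[x xB ox] := hB.
have xA : x \notin A by apply: contra hA => xA; apply/hitsP; exists x.
exists x; first by rewrite inE xA.
have fresh y : y \in A -> own y <> Some l.
  by move=> yA oy; case/hitsP: hA; exists y.
apply/partial_transversalP; split.
- by move=> y /setU1P[->|/A1 //]; rewrite ox.
- move=> y z /setU1P[->|yA] /setU1P[->|zA] //; last exact: A2.
    by rewrite ox => /esym /(fresh z zA).
  by rewrite ox => /(fresh y yA).
- move=> k; have [sk|sk] := eqVneq (stem k) s; last first.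
    have [k' s' h'] := A3 k; exists k' => //; rewrite hitsU1 ox negb_or h' andbT.
    by apply: contra sk => /eqP[e]; rewrite -s' -e sl.
  (* At [s], the legs hit by [A] together with [l] are at most as many as those hit by [B], and [B]
     misses one there. *)
  have lt' : #|l |: at_stem A s| < #|[set k' | stem k' == s]|.
    apply: (@leq_ltn_trans #|at_stem B s|).
      by apply: leq_trans lts; rewrite cardsU1; case: (_ \notin _).
    apply: proper_card; apply/properP; split.
      by apply/subsetP => k'; rewrite !inE => /andP[].
    have [k' s' h'] := B3 l; exists k'; first by rewrite inE s' sl.
    by rewrite inE (negPf h').
  have [k'] : exists k', k' \in [set k' | stem k' == s] :\: (l |: at_stem A s).
    apply/set0Pn; rewrite setD_eq0; apply: contraL lt' => /subset_leq_card.
    by rewrite leqNgt.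
  rewrite !inE negb_or => /andP[/andP[kl h'] /eqP s'].
  move: h'; rewrite s' eqxx andbT => h'.
  exists k'; first by rewrite sk.
  by rewrite hitsU1 ox negb_or h' andbT; apply: contra kl => /eqP[->].
Qed.

Lemma almost_transversal_matroid (I : {set {set V}}) :
  (forall A : {set V}, reflect (exists2 R, minset almost_transversal R & A \subset R)
                     (A \in I)) ->
  is_matroid I.
Proof.
move=> IP.
have IE (A : {set V}) : (A \in I) = partial_transversal A.
  exact/IP/sub_minset_transversalP.
split; first split.
- by rewrite IE partial_transversal0.
- by move=> A B AB; rewrite !IE; apply: partial_transversal_sub.
- move=> A B; rewrite !IE => pA pB /(partial_transversal_exchange pA pB)[x xBA].
  by exists x => //; rewrite IE.
Qed.

End AlmostTransversals.

(** * The path metric of a connected graph *)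

Section TreeMetric.

Variable (T : sgraph).
Hypotheses (cT : connected T) (aT : acyclic T).
Implicit Types (u v w x y h a b : T).
Local Notation d := (@dist T).
Local Notation e := (@edge T).

Lemma uniq_size_lt_card u (p : seq T) : uniq (u :: p) -> size p < #|T|.
Proof. by move=> /card_uniqP /= <-; apply: max_card. Qed.

Lemma dist_le_path u v p : path e u p -> last u p = v -> d u v <= size p.
Proof.
move=> pp lp; have [p' [pp' up' sub' lp']] : exists p',
    [/\ path e u p', uniq (u :: p'), size p' <= size p & last u p' = v].
  case: (shortenP pp) lp => p' pp' up' sub' lp'; exists p'; split=> //.
  by apply: uniq_leq_size => //; case/andP: up'.
apply: leq_trans sub'; rewrite /dist leqNgt; apply/negP => lt.
have szp' := uniq_size_lt_card up'.
have := before_find 0 lt; rewrite nth_iota // add0n => /negbT/negP; apply.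
apply/existsP; exists (in_tuple p'); rewrite pp' up' /=; exact/eqP.
Qed.

(** Connectivity makes the search in [dist] succeed, so its junk value never occurs. *)
Lemma geodesic u v :
  exists p, [/\ path e u p, uniq (u :: p), last u p = v & size p = d u v].
Proof.
have [p0 pp0 lp0] := connectP (cT u v).
case: (shortenP pp0) lp0 => p pp up _ lp.
have szp := uniq_size_lt_card up.
have hasd : has (has_path_of_length u v) (iota 0 #|T|).
  apply/hasP; exists (size p); first by rewrite mem_iota.
  by apply/existsP; exists (in_tuple p); rewrite pp up -lp /=.
have := nth_find 0 hasd.
rewrite nth_iota; last by rewrite -{2}(size_iota 0 #|T|) -has_find.
rewrite add0n => /existsP[q /and3P[pq uq /eqP lq]].
by exists q; split=> //; rewrite size_tuple.
Qed.

Lemma dist_lt_card u v : d u v < #|T|.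
Proof.
by have [p [_ /uniq_size_lt_card lt _ <-]] := geodesic u v.
Qed.

Lemma dist_refl u : d u u = 0.
Proof. by apply/eqP; rewrite -leqn0 (@dist_le_path u u [::]). Qed.

Lemma dist_eq0 u v : (d u v == 0) = (u == v).
Proof.
apply/eqP/eqP => [d0|->]; last exact: dist_refl.
by have [p [_ _ lp]] := geodesic u v; rewrite d0 -lp => /size0nil ->.
Qed.

Lemma dist_sym u v : d u v = d v u.
Proof.
suff le x y : d x y <= d y x by apply/eqP; rewrite eqn_leq !le.
have [p [pp _ lp <-]] := geodesic y x.
rewrite -(size_belast y p) -size_rev.
apply: dist_le_path; last by case: p {pp} lp => //= z p; rewrite rev_cons last_rcons.
rewrite -lp rev_path (@eq_path _ _ e) // => a b; exact: edge_sym.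
Qed.

Lemma dist_triangle v u w : d u w <= d u v + d v w.
Proof.
have [p [pp _ lp <-]] := geodesic u v; have [q [pq _ lq <-]] := geodesic v w.
by rewrite -size_cat; apply: dist_le_path; rewrite ?cat_path ?last_cat ?lp ?pp.
Qed.

Lemma dist_edge u v : e u v -> d u v = 1.
Proof.
move=> uv; apply/eqP; rewrite eqn_leq (@dist_le_path u v [:: v]) /= ?uv //.
rewrite lt0n dist_eq0; apply: contraTneq uv => ->.
by rewrite edge_irrefl.
Qed.

Lemma dist_edge_le u v x : e u v -> d v x <= (d u x).+1.
Proof.
by move=> uv; apply: leq_trans (dist_triangle u v x) _;
  rewrite dist_sym (dist_edge uv).
Qed.

Lemma closer_neighbor u v : u != v -> exists2 u', e u u' & d u v = (d u' v).+1.
Proof.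
move=> uv; have [[|u' p] /= [pp _ lp szp]] := geodesic u v.
  by rewrite lp eqxx in uv.
case/andP: pp => uu' pp; exists u' => //; have := dist_le_path pp lp.
have := dist_edge_le v (etrans (edge_sym _ _) uu'); lia.
Qed.

(** * Bridges and their metric consequences *)

Definition edge_minus a b : rel T :=
  fun x y => [&& e x y, ~~ ((x == a) && (y == b)) & ~~ ((x == b) && (y == a))].

Lemma edge_minus_sym a b : symmetric (edge_minus a b).
Proof.
by move=> x y; rewrite /edge_minus edge_sym; congr (_ && _);
  rewrite andbC [(y == b) && _]andbC [(y == a) && _]andbC.
Qed.

(** A path avoiding the edge would close up with it to a cycle. *)
Lemma edge_bridge a b : e a b -> ~~ connect (edge_minus a b) a b.
Proof.
move=> ab; apply/negP => /connectP[p0 pp0 lp0].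
case: (shortenP pp0) lp0 => p pp up _ lp.
apply: (@aT (a :: p)).
  (* The cycle has at least 3 vertices: an empty path forces [a = b], and a single step would be the
     deleted edge. *)
  case: p pp up lp => [_ _ /= eab|y [|z p]] //=.
    by rewrite eab edge_irrefl in ab.
  by rewrite andbT => /and3P[_ nab _] _ eby; rewrite eby !eqxx in nab.
rewrite /ucycle up andbT /= rcons_path -lp edge_sym ab andbT.
by apply: sub_path pp => x y /and3P[].
Qed.

(** [P] is an invariant carried along a geodesic to [h]; as no step taken under it is the deleted
    edge, the geodesic survives the deletion. *)
Lemma connect_descent (P : pred T) a b h :
  (forall x y, P x -> e x y -> d x h = (d y h).+1 ->
     edge_minus a b x y /\ P y) ->
  forall x, P x -> connect (edge_minus a b) x h.
Proof.
move=> step x; move Ek: (d x h) => k.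
elim: k x Ek => [|k IHk] x Ek Px.
  by move/eqP: Ek; rewrite dist_eq0 => /eqP ->.
have xh : x != h by rewrite -dist_eq0 Ek.
have [y xy dxy] := closer_neighbor xh; have [xy' Py] := step x y Px xy dxy.
by apply: connect_trans (connect1 xy') (IHk y _ Py); lia.
Qed.

(** Trees are bipartite: with both ends equidistant from [h], geodesics from them to [h] never cross
    the edge and together bypass a bridge. *)
Lemma dist_edge_neq u v h : e u v -> d u h != d v h.
Proof.
move=> uv; apply: contraL (edge_bridge uv) => /eqP duv; rewrite negbK.
have conn x : connect (edge_minus u v) x h.
  apply: (@connect_descent predT) => // y z _ yz dyz; split=> //.
  rewrite /edge_minus yz /=.
  apply/andP; split; apply/negP => /andP[/eqP ey /eqP ez];
  by move: dyz; rewrite ey ez; lia.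
apply: connect_trans (conn u) _.
by rewrite (sym_connect_sym (@edge_minus_sym u v)).
Qed.

(** Rooted at [h], [v] has a single parent. Geodesics from [a] and [b] to [h] stay nearer to [h]
    than [v] is, so together with the edge from [v] to [b] they would bypass the bridge between [v]
    and [a]. *)
Lemma closer_neighbor_unique v a b h :
  e v a -> e v b -> d a h < d v h -> d b h < d v h -> a = b.
Proof.
move=> va vb la lb; apply/eqP; apply: contraT => ab.
have := edge_bridge va; case/negP.
have conn x : d x h < d v h -> connect (edge_minus v a) x h.
  apply: (@connect_descent (fun y => d y h < d v h)) => y z ly yz dyz.
  split; last by lia.
  rewrite /edge_minus yz /=.
  apply/andP; split; apply/negP => /andP[/eqP ey /eqP ez];
  by move: dyz ly; rewrite ?ey ?ez; lia.
apply: connect_trans (connect1 _) (connect_trans (conn b lb) _); last first.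
  by rewrite (sym_connect_sym (@edge_minus_sym v a)) conn.
rewrite /edge_minus vb eqxx /= eq_sym ab /=.
by apply/negP => /andP[/eqP eva _]; rewrite eva edge_irrefl in va.
Qed.

Lemma dist_edge_cases u v h :
  e u v -> d u h = (d v h).+1 \/ d v h = (d u h).+1.
Proof.
move=> uv; have := dist_edge_neq h uv; have := dist_edge_le h uv.
by have := dist_edge_le h (etrans (edge_sym _ _) uv); lia.
Qed.

(* Once a geodesic moves away from [h] it keeps doing so. *)
Lemma dist_away u u' w h :
  e u u' -> d u w = (d u' w).+1 -> d u h < d u' h -> d w h = d u h + d u w.
Proof.
move Ek: (d u' w) => k; elim: k u u' Ek => [|k IHk] u u' Ek uu' duw lt.
  move/eqP: Ek; rewrite dist_eq0 => /eqP <-.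
  by rewrite (dist_edge uu'); case: (dist_edge_cases h uu'); lia.
have u'w : u' != w by rewrite -dist_eq0 Ek.
have [u2 uu2 du2] := closer_neighbor u'w.
suff lt2 : d u' h < d u2 h.
  by rewrite (IHk u' u2) ?Ek; try lia; case: (dist_edge_cases h uu'); lia.
case: (dist_edge_cases h uu2) => // gt; last by lia.
(* Otherwise [u] and [u2] are both neighbours of [u'] nearer to [h], hence equal, although only [u2]
   is nearer to [w]. *)
have := @closer_neighbor_unique u' u u2 h; rewrite edge_sym uu' uu2.
by move=> /(_ isT isT lt) eq; rewrite -eq in du2; lia.
Qed.

(** * Branches, degrees and legs *)

(** For an edge [e v a] this is the component of [a] once that edge is deleted; the metric form
    turns membership into arithmetic. *)
Definition branch v a := [set x | d x a < d x v].

Lemma in_branchE v a x : (x \in branch v a) = (d a x < d v x).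
Proof. by rewrite inE ![d x _]dist_sym. Qed.

(** The geodesic from [v] to [w] cannot start towards [x]: its first vertex would then be [a],
    putting [w] in the branch. So [dist_away] applies. *)
Lemma branch_dist v a w x :
  e v a -> x \in branch v a -> w \notin branch v a -> d w x = d v x + d v w.
Proof.
move=> va; rewrite !in_branchE -leqNgt => xa wa.
have [->|vw] := eqVneq v w; first by rewrite dist_refl addn0.
have [v' vv' dv'] := closer_neighbor vw.
apply: (dist_away vv' dv').
case: (dist_edge_cases x vv') => // gt; last by lia.
have eav := @closer_neighbor_unique v a v' x va vv' xa.
by rewrite eav in wa; lia.
Qed.

Definition deg x := #|[set y | e x y]|.

Lemma deg_gt2 x a b c :
  e x a -> e x b -> e x c -> a != b -> b != c -> c != a -> 2 < deg x.
Proof.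
by move=> xa xb xc ab bc ca; apply/card_gt2P; exists a, b, c; rewrite !inE.
Qed.

(** By contraposition: if all degrees are at most 2, the distance to an endpoint [r] is a coordinate
    identifying the tree with a path. *)
Lemma exists_deg_gt2 : 0 < #|T| -> ~ is_path_graph T -> exists v, 2 < deg v.
Proof.
move=> /card_gt0P[x0 _] npT; apply/existsP; apply/contraT => /existsPn small.
case: npT.
have deg2 x a b c : e x a -> e x b -> e x c -> a != b -> b != c -> c = a.
  move=> xa xb xc ab bc; apply/eqP; apply: contraNT (small x) => ca.
  exact: deg_gt2 bc ca.
(* All neighbours of a farthest vertex are nearer to [x0] and hence coincide, so [r] is an
   endpoint. *)
pose r := [arg max_(x > x0) d x x0].
have rmax x : d x x0 <= d r x0 by rewrite /r; case: arg_maxnP => // y _; apply.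
have rleaf a b : e r a -> e r b -> a = b.
  move=> ra rb; apply: (closer_neighbor_unique (h := x0) ra rb).
    by have := rmax a; have := dist_edge_neq x0 ra; lia.
  by have := rmax b; have := dist_edge_neq x0 rb; lia.
have inj x y : d x r = d y r -> x = y.
  move Ek: (d x r) => k; elim: k x y Ek => [|k IHk] x y Ex Ey.
    by move/eqP: Ex; move/esym/eqP: Ey; rewrite !dist_eq0 => /eqP -> /eqP.
  have xr : x != r by rewrite -dist_eq0 Ex.
  have yr : y != r by rewrite -dist_eq0 -Ey.
  have [x' xx' dx'] := closer_neighbor xr; have [y' yy' dy'] := closer_neighbor yr.
  have exy : x' = y' by apply: IHk; lia.
  rewrite -{}exy in yy' dy'.
  rewrite edge_sym in xx'; rewrite edge_sym in yy'.
  (* [x] and [y] share the neighbour [x']. Unless [x'] is the endpoint [r], it has another neighbour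
     [z] towards [r], which leaves room for only one more. *)
  have [e'|x'r] := eqVneq x' r; first by apply: rleaf; rewrite -e'.
  have [z x'z dz] := closer_neighbor x'r.
  apply: (deg2 x' y z x) => //; apply/eqP => eq; rewrite eq in Ey dz *; lia.
pose f (x : T) : path_graph #|T| := Ordinal (dist_lt_card x r).
exists f; split.
  apply: inj_card_bij; last by rewrite card_ord.
  by move=> x y /(congr1 val)/inj.
move=> u v; rewrite /= /consecutive /=; apply/orP/idP; last first.
  by move=> uv; case: (dist_edge_cases r uv) => ->; rewrite eqxx; auto.
have adj x y : (d x r).+1 = d y r -> e y x.
  move=> dxy; have yr : y != r by rewrite -dist_eq0 -dxy.
  have [z yz dz] := closer_neighbor yr.
  by have -> : x = z by apply: inj; lia.
by case=> /eqP/adj //; rewrite edge_sym.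
Qed.

Definition is_leg v a :=
  [&& 2 < deg v, e v a & [forall x in branch v a, deg x <= 2]].

Lemma is_legP v a :
  reflect [/\ 2 < deg v, e v a & forall x, x \in branch v a -> deg x <= 2]
          (is_leg v a).
Proof. by apply: (iffP and3P) => -[? ? /forall_inP]. Qed.

(** Each stem has degree at least 3, so it lies outside the other leg. Then each stem is farther
    from [x] than the other by [d v v'], which must be 0. *)
Lemma is_leg_uniq v a v' a' x :
  is_leg v a -> is_leg v' a' -> x \in branch v a -> x \in branch v' a' ->
  (v, a) = (v', a').
Proof.
move=> /is_legP[dv va la] /is_legP[dv' va' la'] xa xa'.
have nv : v \notin branch v' a' by apply: contraL dv => /la'; rewrite -leqNgt.
have nv' : v' \notin branch v a by apply: contraL dv' => /la; rewrite -leqNgt.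
have D := branch_dist va xa nv'; have D' := branch_dist va' xa' nv.
have /eqP : d v v' = 0 by lia.
rewrite dist_eq0 => /eqP ev; rewrite -{}ev in va' xa' *; congr (_, _).
by rewrite !in_branchE in xa xa'; apply: closer_neighbor_unique xa xa'.
Qed.

(** Take [z] of degree at least 3 in the branch, farthest from [v]. Its branches pointing away from
    [v] contain only vertices farther than [z], so they are legs. *)
Lemma deg_gt2_branch_legs v a w :
  e v a -> w \in branch v a -> 2 < deg w ->
  exists v' a' b', [/\ is_leg v' a', is_leg v' b', a' != b',
    branch v' a' \subset branch v a & branch v' b' \subset branch v a].
Proof.
move=> va wa dw.
have Pw : (w \in branch v a) && (2 < deg w) by rewrite wa.
case: (@arg_maxnP _ w (fun z => (z \in branch v a) && (2 < deg z))
        (fun z => d z v) Pw) => z /andP[za dz] zmax.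
have far c : e z c -> d z v < d c v ->
    is_leg z c /\ branch z c \subset branch v a.
  move=> zc lt.
  have away x : x \in branch z c -> d x v = d x z + d z v /\ x \in branch v a.
    move=> xc.
    have dx : d v x = d z x + d z v.
      apply: (branch_dist zc xc); rewrite in_branchE; lia.
    split; first by rewrite ![d x _]dist_sym.
    rewrite in_branchE dx; apply: leq_ltn_trans (dist_triangle z a x) _.
    by move: za; rewrite in_branchE ![d z _]dist_sym; lia.
  split; last by apply/subsetP => x /away[].
  apply/is_legP; split=> // x xc; have [dx xa] := away x xc.
  rewrite leqNgt; apply/negP => gt.
  have := zmax x; rewrite xa gt => /(_ isT); rewrite /= dx.
  have : 0 < d x z.
    rewrite lt0n dist_eq0; apply: contraTneq xc => ->.
    by rewrite in_branchE dist_refl.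
  lia.
(* Of three neighbours of [z] at most one is nearer to [v], so two of them point away. *)
have [a' [b' [za' zb' ab la lb]]] : exists a' b',
    [/\ e z a', e z b', a' != b', d z v < d a' v & d z v < d b' v].
  have near c c' : e z c -> e z c' -> c != c' -> (d z v < d c v) || (d z v < d c' v).
    move=> zc zc' cc'; apply: contraR cc' => /norP[l l'].
    have := dist_edge_neq v zc; have := dist_edge_neq v zc'; move=> n' n.
    by apply/eqP; apply: (closer_neighbor_unique (h := v) zc zc'); lia.
  have /card_gt2P[c1 [c2 [c3 [[]]]]] := dz; rewrite !inE => e1 e2 e3 [n12 n23 n31].
  have := near _ _ e1 e2 n12; have := near _ _ e2 e3 n23.
  have := near _ _ e3 e1 n31.
  case l1: (d z v < d c1 v); case l2: (d z v < d c2 v); case l3: (d z v < d c3 v) => //.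
  - by exists c1, c2.
  - by exists c1, c2.
  - by exists c3, c1.
  - by exists c2, c3.
have [leg1 sub1] := far _ za' la; have [leg2 sub2] := far _ zb' lb.
by exists z, a', b'.
Qed.

Lemma branch_pair_legs v a b :
  (exists z, 2 < deg z) -> e v a -> e v b -> a != b ->
  exists v' a' b', [/\ is_leg v' a', is_leg v' b', a' != b' &
    branch v' a' :|: branch v' b' \subset branch v a :|: branch v b].
Proof.
move=> [z dz] va vb ab.
have [/existsP[w /andP[wa dw]]|/existsPn Na] :=
  boolP [exists w, (w \in branch v a) && (2 < deg w)].
  have [v' [a' [b' [? ? ? s1 s2]]]] := deg_gt2_branch_legs va wa dw.
  exists v', a', b'; split=> //.
  by apply: subset_trans (subsetUl _ _); rewrite subUset s1.
have [/existsP[w /andP[wb dw]]|/existsPn Nb] :=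
  boolP [exists w, (w \in branch v b) && (2 < deg w)].
  have [v' [a' [b' [? ? ? s1 s2]]]] := deg_gt2_branch_legs vb wb dw.
  exists v', a', b'; split=> //.
  by apply: subset_trans (subsetUr _ _); rewrite subUset s1.
(* The vertex [z] is in neither branch: it is [v] itself, or the neighbour of [v] towards [z] is a
   third one. *)
have dv : 2 < deg v.
  have [<- //|zv] := eqVneq z v.
  rewrite eq_sym in zv; have [c vc dc] := closer_neighbor zv.
  have zc : z \in branch v c by rewrite in_branchE dc.
  apply: (deg_gt2 va vb vc) => //; apply/eqP => eq.
    by have := Nb z; rewrite eq zc dz.
  by have := Na z; rewrite -eq zc dz.
exists v, a, b; split=> //; apply/is_legP; split=> // x xB; rewrite leqNgt.
  by have := Na x; rewrite xB.
by have := Nb x; rewrite xB.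
Qed.

(** * Resolving sets in terms of legs *)

Lemma resolvingP (R : {set T}) :
  reflect (forall u w, u != w -> exists2 h, h \in R & d u h != d w h)
          (resolving R).
Proof.
apply: (iffP forallP) => [H u w uw|H u].
  have /forallP/(_ w)/implyP/(_ uw)/existsP[h /andP[hR dh]] := H u.
  by exists h.
apply/forallP => w; apply/implyP => /H[h hR dh].
by apply/existsP; exists h; rewrite hR.
Qed.

(** A vertex outside both branches is one step farther from [a] and from [b] than from [v], so it
    does not separate them. *)
Lemma resolving_meets_branches (R : {set T}) v a b :
  resolving R -> e v a -> e v b -> a != b ->
  exists2 h, h \in R & h \in branch v a :|: branch v b.
Proof.
move=> /resolvingP res va vb /res[h hR dh]; exists h => //.
apply: contraR dh; rewrite inE !in_branchE => /norP[na nb].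
by case: (dist_edge_cases h va); case: (dist_edge_cases h vb); lia.
Qed.

(* Two vertices not separated by [R] can both be moved one step towards each
   other, until they are neighbours of their midpoint [v]. *)
Lemma unresolved_branches (R : {set T}) u w :
  R != set0 -> u != w -> (forall h, h \in R -> d u h = d w h) ->
  exists v a b, [/\ e v a, e v b, a != b
    & forall h, h \in R -> h \notin branch v a :|: branch v b].
Proof.
move=> /set0Pn[h0 h0R]; have [k] := ubnP (d u w).
elim: k u w => // k IHk u w; rewrite ltnS => duk uw eqR.
(* If the first step towards [y] led away from [h], [dist_away] would make [y] farther from [h] than
   [x] is. *)
have toward x y x' h : e x x' -> d x y = (d x' y).+1 -> d x h = d y h ->
    d x h = (d x' h).+1.
  move=> xx' dx dxy; case: (dist_edge_cases h xx') => // gt.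
  by have := @dist_away x x' y h xx' dx; lia.
have [u' uu' du'] := closer_neighbor uw.
(* Adjacent vertices are never equidistant from [h0]; this is where [R] must be nonempty. *)
have u'w : u' != w.
  apply/eqP => eq; have := dist_edge_neq h0 uu'.
  by rewrite eq eqR // eqxx.
(* [w'] is chosen towards [u'] rather than [u], so that the two moves together shorten the distance
   by 2. *)
rewrite eq_sym in u'w; have [w' ww' dw'] := closer_neighbor u'w.
have dww' : d w u = (d w' u).+1.
  have := dist_triangle u' w' u; have := dist_edge_le u (etrans (edge_sym _ _) ww').
  rewrite (dist_sym u' u) (dist_edge uu') (dist_sym w u).
  by rewrite (dist_sym w u') in dw'; lia.
have eu h : h \in R -> d u h = (d u' h).+1.
  by move=> hR; apply: (toward u w) => //; apply: eqR.
have ew h : h \in R -> d w h = (d w' h).+1.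
  by move=> hR; apply: (toward w u) => //; rewrite eqR.
have [eq'|neq'] := eqVneq u' w'.
  exists u', u, w; split=> [|||h hR] //; first by rewrite edge_sym.
    by rewrite eq' edge_sym.
  by rewrite inE !in_branchE -eqR // (eu h hR); lia.
apply: (IHk u' w') => //; first by rewrite (dist_sym u' w'); rewrite (dist_sym w u') in dw'; lia.
by move=> h hR; have := eu h hR; have := ew h hR; have := eqR h hR; lia.
Qed.

Lemma resolving_legs (R : {set T}) :
  (exists z, 2 < deg z) ->
  resolving R <->
  (forall v a b, is_leg v a -> is_leg v b -> a != b ->
     exists2 h, h \in R & h \in branch v a :|: branch v b).
Proof.
move=> big; split=> [res v a b /is_legP[_ va _] /is_legP[_ vb _]|H].
  exact: resolving_meets_branches.
have H' v a b : e v a -> e v b -> a != b ->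
    exists2 h, h \in R & h \in branch v a :|: branch v b.
  move=> va vb ab; have [v' [a' [b' [la lb ab' sub]]]] := branch_pair_legs big va vb ab.
  by have [h hR /(subsetP sub) hB] := H v' a' b' la lb ab'; exists h.
have Rn0 : R != set0.
  have [z /card_gt2P[a [b [c [[]]]]]] := big; rewrite !inE => za zb _ [ab _ _].
  by have [h hR _] := H' z a b za zb ab; apply/set0Pn; exists h.
apply/resolvingP => u w uw; apply/exists_inP; apply: contraT => /exists_inPn eqR.
have [|v [a [b [va vb ab miss]]]] := unresolved_branches Rn0 uw.
  by move=> h /eqR; rewrite negbK => /eqP.
by have [h hR] := H' v a b va vb ab; rewrite (negPf (miss h hR)).
Qed.

Lemma res_system_matroid : (exists z, 2 < deg z) -> is_matroid (res_system T).
Proof.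
(* A leg is encoded by its stem and its first vertex, which also serves as its point. Disjointness
   of legs makes the [pick] in [owner] unambiguous. *)
move=> big; pose leg := {l : T * T | is_leg l.1 l.2}.
pose owner x : option leg := [pick l : leg | x \in branch (val l).1 (val l).2].
have ownerE x (l : leg) :
    (owner x == Some l) = (x \in branch (val l).1 (val l).2).
  rewrite /owner; case: pickP => [l' xl'|none]; last by rewrite none.
  apply/eqP/idP => [[<-] //|xl]; congr Some; apply: val_inj.
  move: (val l) (val l') (valP l) (valP l') xl xl' => [v a] [v' a'] /= L L' xl xl'.
  by rewrite (is_leg_uniq L L' xl xl').
have own_pt (l : leg) : owner (val l).2 = Some l.
  apply/eqP; rewrite ownerE in_branchE dist_refl.
  by have /is_legP[_ va _] := valP l; rewrite dist_edge.
have resE R : resolving R = almost_transversal owner (fun l : leg => (val l).1) R.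
  apply/idP/almost_transversalP => [/(resolving_legs R big) H l l'|H]; last first.
    apply/(resolving_legs R big) => v a b la lb ab.
    have := H (exist _ (v, a) la) (exist _ (v, b) lb).
    case/(_ _ erefl)/orP; first by apply: contra ab => /eqP[->].
      by case/existsP=> h /andP[hR]; rewrite ownerE => hB; exists h; rewrite ?in_setU ?hB.
    by case/existsP=> h /andP[hR]; rewrite ownerE => hB; exists h; rewrite ?in_setU ?hB ?orbT.
  case: l l' => [[v a] la] [[v' b] lb] ll' /= ev.
  have /= lb' := lb; rewrite -ev in lb'.
  have ab : a != b.
    by apply: contraNneq ll' => eab; apply/eqP; apply: val_inj; rewrite /= ev eab.
  have [h hR] := H v a b la lb' ab; rewrite inE => hB; apply/orP.
  by case/orP: hB => hB; [left|right]; apply/existsP; exists h; rewrite hR ownerE /= -?ev.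
apply: (almost_transversal_matroid own_pt (stem := fun l => (val l).1)) => A.
have minE R : minimal_resolving R =
    minset (almost_transversal owner (fun l : leg => (val l).1)) R.
  exact: minset_eq.
rewrite inE; apply: (iffP existsP) => [[R /andP[]]|[R]].
  by rewrite minE; exists R.
by rewrite -minE => mR AR; exists R; rewrite mR.
Qed.

End TreeMetric.

Theorem theorem2 (T : sgraph) (treeT : is_tree T) (n_ge4 : 4 <= #|T|)
  (not_path : ~ is_path_graph T) : is_matroid (res_system T).
Proof.
have [cT aT] := treeT; apply: res_system_matroid => //.
by apply: exists_deg_gt2 => //; apply: leq_trans n_ge4.
Qed.
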